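(* Let $G(N,S_N,f,A_k)_{k=0}^{\infty}$ be an $n$-person repeated game. Suppose that, for every $i\in N$, $(S_i,\succcurlyeq_i)$ is a nonempty chain-complete poset, and let $S_N=\prod_{i\in N}S_i$ be equipped with the component-wise partial order $\succcurlyeq$. Let $\Pi_k=A_kA_{k-1}\cdots A_1A_0$ for $k=0,1,2,\ldots$, and for $x\in S_N$ put $$\psi(x)=\{t\in S_N:\ f_i((\Pi_kz)_i,(\Pi_kx)_{-i})\le f_i((\Pi_kt)_i,(\Pi_kx)_{-i})\ \text{for every } i\in N,\ \text{all } z\in S_N\ \text{and all } k=0,1,2,\ldots\}.$$ Suppose that the following conditions are satisfied: (a) for every $i\in N$, $f_i$ is order-positive from $(S_i,\succcurlyeq_i)\times(S_{-i},\succcurlyeq_{-i})$ to $(\mathbb{R},\ge)$; (b) for every $x\in S_N$, $\psi(x)$ is a nonempty universally inductive subset of $S_N$; (c) for every $k=1,2,\ldots$, $A_k:S_N\to S_N$ is an $\succcurlyeq$-increasing operator; (d) there are elements $x'\in S_N$ and $u'\in\psi(x')$ satisfying $x'\preccurlyeq u'$. Then the repeated game $G(N,S_N,f,A_k)_{k=0}^{\infty}$ has an infinitely split Nash equilibrium. Moreover, writing $\mathcal{S}(G(N,S_N,f,A_k)_{k=0}^{\infty})$ for the set of all its infinitely split Nash equilibria and $[x')=\{x\in S_N: x\succcurlyeq x'\}$: (i) $(\mathcal{S}(G(N,S_N,f,A_k)_{k=0}^{\infty}),\succcurlyeq)$ is a nonempty inductive poset; (ii) $(\mathcal{S}(G(N,S_N,f,A_k)_{k=0}^{\infty})\cap[x'),\succcurlyeq)$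 is a nonempty inductive poset.
   Context: Games. Let $n\ge 2$ be an integer. An $n$-person game $G(N,S_N,f)$ consists of a set $N$ of $n$ players, a profile set $S_N=\prod_{i\in N}S_i$, where $S_i$ is the strategy set of player $i$, and $f=(f_i)_{i\in N}:S_N\to\mathbb{R}^n$, where $f_i:S_N\to\mathbb{R}$ is the utility function of player $i$. Write $S_{-i}=\prod_{k\in N\setminus\{i\}}S_k$; a profile $x\in S_N$ is written $x=(x_i,x_{-i})$ with $x_i\in S_i$, $x_{-i}\in S_{-i}$. Each $S_i$ is a poset $(S_i,\succcurlyeq_i)$; $\succcurlyeq$ denotes the component-wise partial order on $S_N$ ($y\succcurlyeq x$ iff $y_i\succcurlyeq_i x_i$ for all $i$), and $\succcurlyeq_{-i}$ the component-wise partial order on $S_{-i}$. Repeated game. An $n$-person repeated game $G(N,S_N,f,A_k)_{k=0}^{\infty}$ is an $n$-person game $G(N,S_N,f)$ together with maps $A_k:S_N\to S_N$ for $k=1,2,\ldots$, with $A_0=I$ the identity of $S_N$, and a discount factor $\rho\in(0,1)$. The utilities are assumed bounded: there is $M>0$ with $|f_i(x)|\le M$ for every $i\in N$ and all $x\in S_N$. Infinitely split Nash equilibrium. An infinitely split Nash equilibrium of $G(N,S_N,f,A_k)_{k=0}^{\infty}$ is a profile $\hat x\in S_N$ such that $f_i((\Pi_kz)_i,(\Pi_k\hat x)_{-i})\le f_i((\Pi_k\hat x)_i,(\Pi_k\hat x)_{-i})$ for every $i\in N$, every $z\in S_N$ and every $k=0,1,2,\ldots$. Order-positive. For posets $(X,\succcurlyeq^X)$,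 $(Y,\succcurlyeq^Y)$, $(U,\succcurlyeq^U)$, a map $g:X\times Y\to U$ is order-positive from $X\times Y$ to $U$ if, for all $x,y\in Y$ with $x\preccurlyeq^Y y$ and all $z,t\in X$, $g(z,x)\preccurlyeq^U g(t,x)$ implies $g(z,y)\preccurlyeq^U g(t,y)$. Increasing. $A:S_N\to S_N$ is $\succcurlyeq$-increasing if $x\preccurlyeq y$ implies $Ax\preccurlyeq Ay$. Order notions. A poset is chain-complete if every nonempty chain in it has a least upper bound in it. A poset is inductive if every nonempty chain in it has an upper bound in it. A nonempty subset $D$ of a poset $(P,\succcurlyeq)$ is universally inductive in $P$ if every nonempty chain $C\subseteq P$ such that each $c\in C$ satisfies $c\preccurlyeq d$ for some $d\in D$ has an upper bound belonging to $D$. *)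

(* Defs.v *)
Set Warnings "-redundant-canonical-projection,-notation-overridden,-ambiguous-paths".
From HB Require Import structures.
From mathcomp Require Import all_boot all_order ssralg ssrnum.
From mathcomp Require Import boolp classical_sets reals.


Set Implicit Arguments.
Unset Strict Implicit.
Unset Printing Implicit Defensive.

Import Order.TTheory GRing.Theory Num.Theory.

Local Open Scope classical_set_scope.
Local Open Scope order_scope.

Definition profile (I : finType) (d : Order.disp_t) (T : I -> porderType d) :=
  forall i, T i.

HB.instance Definition _ (I : finType) (d : Order.disp_t)
  (T : I -> porderType d) := Choice.on (profile T).

Section ComponentwiseOrder.
Context (I : finType) (d : Order.disp_t) (T : I -> porderType d).
Implicit Types x y z : profile T.

Definition profile_le x y : bool := [forall i, x i <= y i].

Lemma profile_le_refl : reflexive profile_le.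
Proof. by move=> x; apply/forallP. Qed.

Lemma profile_le_anti : antisymmetric profile_le.
Proof.
move=> x y /andP[/forallP xy /forallP yx].
by apply: functional_extensionality_dep => i; apply/le_anti; rewrite xy yx.
Qed.

Lemma profile_le_trans : transitive profile_le.
Proof.
move=> y x z /forallP xy /forallP yz; apply/forallP => i.
exact: le_trans (xy i) (yz i).
Qed.

HB.instance Definition _ := Order.Le_isPOrder.Build d (profile T)
  profile_le_refl profile_le_anti profile_le_trans.

Lemma profile_leP x y : reflect (forall i, x i <= y i) (x <= y).
Proof. exact: forallP. Qed.

End ComponentwiseOrder.

Definition others_profile (N : finType) (d : Order.disp_t)
    (S : N -> porderType d) (i : N) :=
  profile (fun k : {k : N | k != i} => S (val k)).

Definition others (N : finType) (d : Order.disp_t) (S : N -> porderType d)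
    (i : N) (x : profile S) : others_profile S i :=
  fun k => x (val k).
Arguments others {N d S} i x _.

Section Deviations.
Context (N : finType) (d : Order.disp_t) (S : N -> porderType d).

(* The profile (a, b) with a the strategy of player i and b those of the
   other players. *)
Definition combine (i : N) (a : S i) (b : others_profile S i) : profile S :=
  fun k => match eq_comparable k i with
           | left ki => ecast j (S j) (esym ki) a
           | right ki => b (Sub k (introN (k =P i) ki))
           end.

Lemma combine_own (i : N) (a : S i) (b : others_profile S i) : combine a b i = a.
Proof.
rewrite /combine; case: (eq_comparable i i) => // ii.
by rewrite (eq_axiomK (esym ii)).
Qed.

Lemma combine_others (i : N) (a : S i) (b : others_profile S i) :
  others i (combine a b) = b.
Proof.
apply: functional_extensionality_dep => -[k ki]; rewrite /others /combine /=.
case: (eq_comparable k i) => [ki'|ki']; first by case: (elimN eqP ki).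
by congr (b (Sub _ _)); exact: bool_irrelevance.
Qed.

Lemma combineE (i : N) (x : profile S) : combine (x i) (others i x) = x.
Proof.
apply: functional_extensionality_dep => k; rewrite /combine.
by case: (eq_comparable k i) => // ki; move: (esym ki) => {ki} ik; case: k / ik.
Qed.

End Deviations.

Section OrderNotions.
Context (d : Order.disp_t) (P : porderType d).
Implicit Types C D : set P.

Definition chain C := total_on C (fun x y => x <= y).

(* Applied to a subset D of P, which carries the order induced by P. *)
Definition inductive_poset D :=
  forall C, C `<=` D -> C !=set0 -> chain C -> exists2 u, D u & ubound C u.

Definition universally_inductive D :=
  D !=set0 /\
  forall C, C !=set0 -> chain C ->
    (forall c, C c -> exists2 e, D e & c <= e) ->
    exists2 u, D u & ubound C u.

End OrderNotions.

Definition chain_complete (d : Order.disp_t) (P : porderType d) :=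
  forall C : set P, C !=set0 -> chain C -> exists s, supremums C s.

Definition order_positive (dX dY dU : Order.disp_t) (X : porderType dX)
    (Y : porderType dY) (U : porderType dU) (g : X * Y -> U) :=
  forall (x y : Y) (z t : X), x <= y -> g (z, x) <= g (t, x) ->
    g (z, y) <= g (t, y).

Record repeated_game (R : realType) (N : finType) (d : Order.disp_t)
    (S : N -> porderType d) := RepeatedGame {
  utility : N -> profile S -> R;
  transition : nat -> profile S -> profile S;
  transition0 : transition 0 = id;
  discount : R;
  discount_itv : (0 < discount < 1)%R;
  utility_bounded :
    exists2 M : R, (0 < M)%R & forall i x, (`|utility i x| <= M)%R }.

Section RepeatedGames.
Context (R : realType) (N : finType) (d : Order.disp_t) (S : N -> porderType d).
Context (G : repeated_game R S).

(* The composite A_k \o ... \o A_1 \o A_0 of the transitions A_j. *)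
Fixpoint iterated_transition (k : nat) : profile S -> profile S :=
  if k is j.+1 then transition G k \o iterated_transition j
  else transition G 0.

Local Notation Pi := iterated_transition.

(* The utility of player i as a function on S_i * S_{-i}. *)
Definition split_utility (i : N) (p : S i * others_profile S i) : R :=
  utility G i (combine p.1 p.2).

Definition split_best_response (x : profile S) : set (profile S) :=
  [set t | forall (i : N) (z : profile S) (k : nat),
    split_utility (Pi k z i, others i (Pi k x)) <=
    split_utility (Pi k t i, others i (Pi k x))].

Definition infinitely_split_Nash : set (profile S) :=
  [set x | forall (i : N) (z : profile S) (k : nat),
    split_utility (Pi k z i, others i (Pi k x)) <=
    split_utility (Pi k x i, others i (Pi k x))].

End RepeatedGames.

(* Main.v *)
(** Order-positivity and monotonicity of the operators [Pi k] make the joint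
    best-response map [psi] monotone for inclusion, and its fixed points
    [x \in psi x] are exactly the infinitely split Nash equilibria.  Let [E] be
    the set of all [x] lying below some element of [psi x].  If [s] is the
    supremum of a chain in [E], each element of the chain lies below an element
    of [psi s], so universal inductivity bounds the chain by an element of
    [psi s], and [s] is in [E].  By Zorn's lemma every point of [E] lies below a
    maximal one, and maximal points [m <= u \in psi m `<=` psi u] are fixed. *)
Require Import Defs.
From mathcomp Require Import all_boot all_order ssralg ssrnum.
From mathcomp Require Import boolp classical_sets reals.

Import Order.TTheory.

Local Open Scope classical_set_scope.
Local Open Scope order_scope.

(** Each projection of a chain is a chain, so suprema can be chosen coordinate by coordinate. *)
Lemma profile_chain_complete (I : finType) (d : Order.disp_t)
    (T : I -> porderType d) :
  (forall i, chain_complete (T i)) -> chain_complete (profile T).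
Proof.
move=> Tcc C [c0 Cc0] chC.
have supC i : {s : T i | supremums [set x i | x in C] s}.
  apply/cid/Tcc; first by exists (c0 i), c0.
  move=> _ _ [x Cx <-] [y Cy <-].
  by case: (chC x y Cx Cy) => /profile_leP/(_ i); [left|right].
exists (fun i => sval (supC i)); split.
  move=> x Cx; apply/profile_leP => i.
  by case: (svalP (supC i)) => + _; apply; exists x.
move=> y yub; apply/profile_leP => i.
case: (svalP (supC i)) => _; apply => _ [x Cx <-].
by have /profile_leP := yub x Cx.
Qed.

(** Zorn's lemma applied to the elements of [D] above [a], so that the maximal element dominates
    [a]. *)
Lemma inductive_poset_maximal (d : Order.disp_t) (P : porderType d) (D : set P)
    (a : P) :
  inductive_poset D -> D a ->
  exists m, [/\ D m, a <= m & forall y, D y -> m <= y -> y = m].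
Proof.
move=> indD Da; pose T := {x : P | D x /\ a <= x}.
have [||||m mmax] := @Zorn T (fun s t => sval s <= sval t).
- by move=> t; exact: lexx.
- by move=> r s t; exact: le_trans.
- by move=> s t st ts; apply/eq_sig_hprop;
    [move=> *; exact: Prop_irrelevance | apply/le_anti/andP].
- move=> A chA.
  have [[t0 At0]|A0] := pselect (A !=set0); last first.
    (* Inductivity says nothing about the empty chain; [a] itself bounds it. *)
    by exists (exist _ a (conj Da (lexx a))) => s As; case: A0; exists s.
  have [|||u Du uub] := indD [set sval t | t in A].
  + by move=> _ [t _ <-]; case: (svalP t).
  + by exists (sval t0), t0.
  + by move=> _ _ [s As <-] [t At <-]; exact: chA.
  have tu t : A t -> sval t <= u by move=> At; apply: uub; exists t.
  have au : a <= u by apply: le_trans (tu _ At0); case: (svalP t0).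
  by exists (exist _ u (conj Du au)) => s /tu.
have [Dm am] := svalP m; exists (sval m); split => // y Dy my.
by have <- := mmax (exist _ y (conj Dy (le_trans am my))) my.
Qed.

Section MonotoneCorrespondence.
Context {d : Order.disp_t} {P : porderType d} (F : P -> set P).
Hypothesis P_chain_complete : chain_complete P.
Hypothesis F_mono : forall x y, x <= y -> F x `<=` F y.
Hypothesis F_univ_inductive : forall x, universally_inductive (F x).

Let E : set P := [set x | exists2 u, F x u & x <= u].

Lemma supremum_below_image (C : set P) (s : P) :
  C `<=` E -> C !=set0 -> chain C -> supremums C s -> E s.
Proof.
move=> CE C0 chC [sub slub].
have [_ /(_ C C0 chC)[|u Fu uub]] := F_univ_inductive s.
  move=> c Cc; have [u Fu cu] := CE c Cc.
  by exists u => //; exact: F_mono _ _ (sub c Cc) _ Fu.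
by exists u => //; exact: slub.
Qed.

Lemma fixpoint_above (x u : P) :
  F x u -> x <= u -> exists2 m, F m m & x <= m.
Proof.
move=> Fxu xu; have [||m [[v Fv mv] xm mmax]] := @inductive_poset_maximal _ _ E x.
- move=> C CE C0 chC; have [s ss] := P_chain_complete C C0 chC.
  by exists s; [exact: supremum_below_image C s CE C0 chC ss | case: ss].
- by exists u.
(* Monotonicity carries [v] from [F m] into [F v], so [v] is again in [E] and maximality of [m]
   applies. *)
exists m => //; have vm : v = m.
  by apply: mmax => //; exists v => //; exact: F_mono _ _ mv _ Fv.
by rewrite -{2}vm.
Qed.

(** Fixed points lie in [E], hence so does the supremum of a chain of them. It may fail to be fixed,
    but a fixed point above it bounds the chain. *)
Lemma fixpoint_inductive : inductive_poset [set x | F x x].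
Proof.
move=> C CF C0 chC; have [s ss] := P_chain_complete C C0 chC.
have [|u Fu su] := @supremum_below_image C s _ C0 chC ss.
  by move=> c /CF Fc; exists c.
have [m Fm sm] := fixpoint_above _ _ Fu su.
by exists m => // c Cc; apply: le_trans sm; case: ss => + _; apply.
Qed.

End MonotoneCorrespondence.

(** Any member of the nonempty chain puts its upper bound above [a]. *)
Lemma inductive_poset_upset (d : Order.disp_t) (P : porderType d) (D : set P)
    (a : P) :
  inductive_poset D -> inductive_poset (D `&` [set x | a <= x]).
Proof.
move=> indD C CD C0 chC; have [|u Du uub] := indD C _ C0 chC.
  by move=> c /CD[].
exists u => //; split => //; case: C0 => c Cc.
by apply: le_trans (uub c Cc); case: (CD c Cc).
Qed.

Section SplitBestResponse.
Context {R : realType} {N : finType} {d : Order.disp_t} {S : N -> porderType d}.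
Context (G : repeated_game R S).
Hypothesis transition_increasing :
  forall k, (1 <= k)%N -> {homo transition G k : x y / x <= y}.

Lemma iterated_transition_increasing (k : nat) :
  {homo iterated_transition G k : x y / x <= y}.
Proof.
elim: k => [|k IHk] x y xy /=; first by rewrite transition0.
by apply: transition_increasing => //; exact: IHk.
Qed.

Lemma split_best_response_mono :
  (forall i, order_positive (split_utility G (i := i))) ->
  forall x y, x <= y -> split_best_response G x `<=` split_best_response G y.
Proof.
(* Passing from [x] to [y] changes only the opponents' part of each inequality, and raises it. *)
move=> utility_op x y xy t tx i z k; apply: utility_op (tx i z k).
apply/profile_leP => j.
by have /profile_leP := iterated_transition_increasing k _ _ xy; exact.
Qed.

End SplitBestResponse.

Theorem theorem2 (R : realType) (n : nat) (N : finType) (d : Order.disp_t)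
    (S : N -> porderType d) (G : repeated_game R S) (x' u' : profile S)
    (n_ge2 : (2 <= n)%N) (cardN : #|N| = n)
    (S_nonempty : forall i, inhabited (S i))
    (S_chain_complete : forall i, chain_complete (S i))
    (utility_order_positive : forall i, order_positive (split_utility G (i := i)))
    (split_best_response_univ_inductive :
      forall x, universally_inductive (split_best_response G x))
    (transition_increasing :
      forall k, (1 <= k)%N -> {homo transition G k : x y / x <= y})
    (u'_best_response : split_best_response G x' u')
    (x'_le_u' : x' <= u') :
  (exists x, infinitely_split_Nash G x) /\
  (infinitely_split_Nash G !=set0 /\
   inductive_poset (infinitely_split_Nash G)) /\
  (infinitely_split_Nash G `&` [set x | x' <= x] !=set0 /\
   inductive_poset (infinitely_split_Nash G `&` [set x | x' <= x])).
Proof.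
have cc := profile_chain_complete _ _ _ S_chain_complete.
have mono := split_best_response_mono _ transition_increasing utility_order_positive.
have [m mNash x'm] := fixpoint_above _ cc mono split_best_response_univ_inductive
  _ _ u'_best_response x'_le_u'.
(* The equilibrium set is by conversion the fixed-point set of [split_best_response G]. *)
have ind : inductive_poset (infinitely_split_Nash G).
  exact: (fixpoint_inductive _ cc mono split_best_response_univ_inductive).
split; first by exists m.
split; split => //; [by exists m | by exists m |].
exact: inductive_poset_upset.
Qed.
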